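(* Let $I$ be a translation-invariant $\sigma$-ideal on $\mathbb{R}$ (containing all singletons, not containing $\mathbb{R}$). If $I$ has property (M), then $I$ has property (M$^*$).
   Context: $I$ is translation invariant if $A\in I$ and $x\in\mathbb{R}$ imply $A+x\in I$. Property (M): there is a Borel function $f:\mathbb{R}\to\mathbb{R}$ with $f^{-1}[\{x\}]\notin I$ for every $x\in\mathbb{R}$. Property (M$^*$): there is a Borel function $f:\mathbb{R}\to\mathbb{R}$ such that $f^{-1}[\{x\}]\cap U\notin I$ for every $x\in\mathbb{R}$ and every nonempty open $U\subseteq\mathbb{R}$. *)

(* Defs.v *)
(* The real line is an arbitrary [R : realType]
   (any realType is a complete archimedean ordered field, i.e. a copy of R);
   its measurable sets are the canonical Borel sets of lebesgue_measure.v. *)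
From HB Require Import structures.
From mathcomp Require Import all_boot all_order all_algebra.
From mathcomp Require Import all_classical all_reals all_analysis.
Set Implicit Arguments. Unset Strict Implicit. Unset Printing Implicit Defensive.
Import Order.TTheory GRing.Theory Num.Theory numFieldNormedType.Exports.
Local Open Scope classical_set_scope.
Local Open Scope ring_scope.

Section Ideals.
Variable R : realType.

Definition sigma_ideal (I : set (set R)) : Prop :=
  [/\ (forall A B : set R, A `<=` B -> I B -> I A),
      (forall F : nat -> set R, (forall n, I (F n)) -> I (\bigcup_n F n)),
      (forall x : R, I [set x]) &
      ~ I setT].

Definition translation_invariant (I : set (set R)) : Prop :=
  forall (A : set R) (x : R), I A -> I ((fun y => y + x) @` A).

Definition propM (I : set (set R)) : Prop :=
  exists f : R -> R, measurable_fun setT f /\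
    forall x : R, ~ I (f @^-1` [set x]).

Definition propMstar (I : set (set R)) : Prop :=
  exists f : R -> R, measurable_fun setT f /\
    forall (x : R) (U : set R), open U -> U !=set0 ->
      ~ I (f @^-1` [set x] `&` U).
End Ideals.

(* Main.v *)
Require Import Defs.
From mathcomp Require Import all_boot all_order all_algebra.
From mathcomp Require Import all_classical all_reals all_analysis.
From mathcomp Require Import measurable_realfun lra zify.

(** Call a set [A] rich when some Borel map into the Cantor space has all its
    fibres on [A] outside of [I]; by (M) the whole line is rich.  Since the
    Cantor space is Borel isomorphic to its countable power, a diagonal
    argument shows that one of countably many sets covering a rich set is rich.
    As countably many translates of a nonempty open set cover the line, every
    nonempty open set is rich.  A rich set splits into continuum many disjoint
    rich sets, so a basis of open sets can be refined, one member at a time, to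
    a sequence of pairwise disjoint rich Borel sets, on which the witnessing
    maps are glued together. *)

Set Implicit Arguments.
Unset Strict Implicit.
Unset Printing Implicit Defensive.
Import Order.TTheory GRing.Theory Num.Theory numFieldNormedType.Exports.
Local Open Scope classical_set_scope.
Local Open Scope ring_scope.

(** * Rich sets *)

(* A sequence [E] of sets encodes the map [p |-> (p \in E i)_i] into the Cantor
   space, and [fiber E b] is its fibre over [b]. *)
Definition fiber (T : Type) (E : nat -> set T) (b : nat -> bool) : set T :=
  [set p | forall i, E i p <-> b i].

Definition rich_for (R : realType) (I : set (set R)) (E : nat -> set R)
    (A : set R) : Prop :=
  forall b, ~ I (A `&` fiber E b).

Definition rich (R : realType) (I : set (set R)) (A : set R) : Prop :=
  exists2 E : nat -> set R, (forall i, measurable (E i)) & rich_for I E A.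

Lemma measurable_fiber (R : realType) (E : nat -> set R) (b : nat -> bool) :
  (forall i, measurable (E i)) -> measurable (fiber E b).
Proof.
move=> mE.
rewrite (_ : fiber E b = \bigcap_i (if b i then E i else ~` E i)).
  by apply: bigcapT_measurable => i; case: (b i) => //; exact: measurableC.
apply/seteqP; split => p /=.
  by move=> h i _; have := h i; case: (b i) => -[h1 h2] //=; [exact: h2|move/h1].
by move=> h i; have := h i Logic.I; case: (b i) => /= h1; split.
Qed.

Lemma richS (R : realType) (I : set (set R)) (A B : set R) :
  sigma_ideal I -> A `<=` B -> rich I A -> rich I B.
Proof.
move=> [sub _ _ _] AB [E mE rE]; exists E => // b Ib; apply: (rE b).
by apply: sub Ib => p [/AB].
Qed.

(** [pickle] splits [E] into one sequence per [k]. If each [F k] had a fibre in [I] over some [b k],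
    merging these codes into one would give a fibre on [A] covered by countably many members of
    [I]. *)
Lemma rich_bigcup (R : realType) (I : set (set R)) (A : set R)
    (F : nat -> set R) :
  sigma_ideal I -> A `<=` \bigcup_k F k -> rich I A -> exists k, rich I (F k).
Proof.
move=> [sub cup _ _] AF [E mE rE]; apply: contrapT => nr.
have bad k : exists b, I (F k `&` fiber (fun i => E (pickle (k, i))) b).
  apply: contrapT => h; apply: nr; exists k.
  by exists (fun i => E (pickle (k, i))) => // b Ib; apply: h; exists b.
have [b hb] := choice bad.
pose c n := if unpickle n is Some (k, i) then b k i else false.
apply: (rE c); apply: sub (cup _ hb) => p [/AF[k _ Fp] Ep].
by exists k => //; split=> // i; have := Ep (pickle (k, i)); rewrite /c pickleK.
Qed.

Lemma rich_setU (R : realType) (I : set (set R)) (A B C : set R) :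
  sigma_ideal I -> A `<=` B `|` C -> rich I A -> rich I B \/ rich I C.
Proof.
move=> hI ABC rA.
have [|[|k] /= rk] := @rich_bigcup R I A (fun k => if k is 0 then B else C) hI _ rA.
- by move=> p /ABC[] ?; [exists 0%N|exists 1%N].
- by left.
- by right.
Qed.

Lemma rich_translate (R : realType) (I : set (set R)) (A : set R) (q : R) :
  sigma_ideal I -> translation_invariant I ->
  rich I [set p | A (p - q)] -> rich I A.
Proof.
move=> [sub _ _ _] tr [E mE rE].
exists (fun i => (fun p => p + q) @^-1` E i) => [i|b Ib].
  rewrite -[X in measurable X]setTI.
  by apply: (measurable_funD (@measurable_id _ _ setT) (measurable_cst q)).
apply: (rE b); apply: sub (tr _ q Ib) => p [Ap Ep].
exists (p - q); last by rewrite subrK.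
by split => // i; rewrite /preimage /= subrK.
Qed.

Lemma open_rich (R : realType) (I : set (set R)) (U : set R) :
  sigma_ideal I -> translation_invariant I -> rich I setT ->
  open U -> U !=set0 -> rich I U.
Proof.
move=> hI tr rT oU [u Uu].
have [e /= e0 eU] : \forall e \near 0^'+, ball u e `<=` U.
  exact: open_subball.
pose q n : R := ratr (odflt 0 (@unpickle rat n)).
have [|k] := @rich_bigcup R I setT (fun k => [set p | U (p - q k)]) hI _ rT.
  move=> p _.
  have e2 : 0 < e / 2 by rewrite divr_gt0.
  (* A rational [r] just above [p - u] puts [p - r] within [e / 2] of [u]. *)
  have [r] := @rat_in_itvoo R (p - u) (p - u + e / 2) ltac:(lra).
  rewrite in_itv /= => /andP[r1 r2]; exists (pickle r) => //=.
  rewrite /q pickleK /=; apply: (eU (e / 2)) => //=.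
    by rewrite sub0r normrN gtr0_norm //; lra.
  by rewrite /ball /= ltr_norml; lra.
exact: rich_translate.
Qed.

(** * Disjoint refinement and gluing *)

(** [C] is the part of the line already used up. The even-indexed sets of [E] cut [U n] minus [C]
    into pieces [D t], and the odd-indexed ones keep each piece rich. *)
Lemma refine_step (R : realType) (I : set (set R)) (U : nat -> set R)
    (C : set R) (n : nat) :
  sigma_ideal I -> (forall m, measurable (U m)) ->
  measurable C -> (forall m, rich I (U m `\` C)) ->
  exists D, [/\ measurable D, C `<=` D, forall m, rich I (U m `\` D) &
    rich I (U n `&` (D `\` C))].
Proof.
move=> hI mU mC rC; have [E mE rE] := rC n.
pose D t := (U n `\` C) `&` fiber (fun i => E i.*2) t.
have rD t : rich I (D t).
  exists (fun i => E i.*2.+1) => // b Ib.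
  apply: (rE (fun j => if odd j then b j./2 else t j./2)).
  case: hI => sub _ _ _; apply: sub Ib => p [Wp Ep].
  split; [split=> // i|move=> i].
    by have := Ep i.*2; rewrite odd_double doubleK.
  by have := Ep i.*2.+1; rewrite /= odd_double /= uphalf_double.
(* [U m `\` C] stays rich after the removal of [D t] for all but at most one
   [t], and it suffices to avoid that [t] at its [m]-th bit. *)
have avoid m : exists c : bool, forall t, t m = c -> rich I ((U m `\` C) `\` D t).
  apply: contrapT => h.
  have bad c : exists2 t, t m = c & ~ rich I ((U m `\` C) `\` D t).
    apply: contrapT => h'; apply: h; exists c => t tm.
    by apply: contrapT => nr; apply: h'; exists t.
  have [t tm nt] := bad true; have [s sm ns] := bad false.
  (* [t] and [s] differ at [m], so [D t] and [D s] are disjoint and the two remainders cover the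
     whole. *)
  suff : rich I ((U m `\` C) `\` D t) \/ rich I ((U m `\` C) `\` D s) by case.
  apply: rich_setU (rC m) => // p Wp.
  have [[Wn Et]|] := pselect (D t p); last by left.
  right; split=> // -[_ Es].
  by have [_ /(_ tm)/(Es m)] := Et m; rewrite sm.
have [t ht] := choice avoid.
exists (C `|` D t); split.
- apply: measurableU => //; apply: measurableI; first exact: measurableD.
  exact: measurable_fiber.
- by move=> p; left.
- move=> m; rewrite setDUr; apply: richS (ht m t erefl) => // p [[Up Cp] Dp].
  by split; split.
- apply: richS (rD t) => // p Dp; case: (Dp) => -[Up Cp] _.
  by do 2?split=> //; right.
Qed.

Lemma rich_disjoint_refinement (R : realType) (I : set (set R))
    (U : nat -> set R) :
  sigma_ideal I -> (forall m, measurable (U m)) -> (forall m, rich I (U m)) ->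
  exists B : nat -> set R, [/\ forall n, measurable (B n),
    forall n, B n `<=` U n, forall n, rich I (B n) & trivIset setT B].
Proof.
move=> hI mU rU.
pose good C := measurable C /\ forall m, rich I (U m `\` C).
have step (x : nat * set R) : exists D, good x.2 ->
    [/\ good D, x.2 `<=` D & rich I (U x.1 `&` (D `\` x.2))].
  (* The default [set0] only makes the choice function total; every [C n] below is good. *)
  have [[mC rC]|ng] := pselect (good x.2); last by exists set0.
  have [D [mD CD rD1 rD2]] := refine_step x.1 hI mU mC rC.
  by exists D.
have [F hF] := choice step.
pose C := fix C n := if n is m.+1 then F (m, C m) else set0.
have gC n : good (C n).
  elim: n => [|n ih]; last by case: (hF (n, C n) ih).
  by split=> [|m]; [exact: measurable0|rewrite /= setD0; exact: rU].
have C_S n : C n `<=` C n.+1 by case: (hF (n, C n) (gC n)).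
have C_mono m n : (m <= n)%N -> C m `<=` C n.
  elim: n => [|n ih]; first by rewrite leqn0 => /eqP->.
  by rewrite leq_eqVlt ltnS => /predU1P[->//|/ih h] p /h /C_S.
have lt_disj m n p : (m < n)%N -> C m.+1 p -> ~ C n p -> False.
  by move=> mn Cp nCp; exact/nCp/(C_mono _ _ mn).
exists (fun n => U n `&` (C n.+1 `\` C n)); split.
- move=> n; apply: measurableI => //.
  exact: measurableD (proj1 (gC n.+1)) (proj1 (gC n)).
- by move=> n p [].
- by move=> n; case: (hF (n, C n) (gC n)).
- move=> m n _ _ [p [[_ [p1 p2]] [_ [p3 p4]]]].
  by case: (ltngtP m n) => // mn; exfalso;
    [exact: lt_disj mn p1 p4|exact: lt_disj mn p3 p2].
Qed.

(** On each member of a disjoint refinement the glued sequence agrees with the local witness, so one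
    sequence serves all [U m]. *)
Lemma rich_for_glue (R : realType) (I : set (set R)) (U : nat -> set R) :
  sigma_ideal I -> (forall m, measurable (U m)) -> (forall m, rich I (U m)) ->
  exists2 E : nat -> set R,
    (forall i, measurable (E i)) & forall m, rich_for I E (U m).
Proof.
move=> hI mU rU.
have [B [mB BU rB tB]] := rich_disjoint_refinement hI mU rU.
have ex n : exists E : nat -> set R,
    (forall i, measurable (E i)) /\ rich_for I E (B n).
  by have [E] := rB n; exists E.
have [E hE] := choice ex.
exists (fun i => \bigcup_n (B n `&` E n i)).
  move=> i; apply: bigcupT_measurable => n; apply: measurableI => //.
  by have [] := hE n.
move=> m b Ib; have [_ /(_ b)] := hE m; apply.
case: hI => sub _ _ _; apply: sub Ib => p [Bp Ep].
split; [exact: BU|move=> i; rewrite -(Ep i); split].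
  by move=> [n _ [Bn En]]; rewrite -(tB n m Logic.I Logic.I) //; exists p.
by move=> ?; exists m.
Qed.

(** * Coding the Cantor space by reals *)

(** For nonnegative [z]: the base 4 digit of [z] at place [n.+1] after the point is odd. *)
Definition digit (R : realType) (n : nat) : set R :=
  [set z | exists k : nat, (k.*2.+1)%:R <= z * 4 ^+ n.+1 < (k.*2.+2)%:R].

Lemma measurable_digit (R : realType) (n : nat) : measurable (@digit R n).
Proof.
rewrite (_ : digit n = \bigcup_k
    ((fun z : R => z * 4 ^+ n.+1) @^-1` `[(k.*2.+1)%:R, (k.*2.+2)%:R[)).
  apply: bigcupT_measurable => k; rewrite -[X in measurable X]setTI.
  apply: (measurable_funM (@measurable_id _ _ setT) (measurable_cst _)) => //.
apply/seteqP; split=> z /=.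
  by move=> [k hk]; exists k => //=; rewrite in_itv.
by move=> [k _ /=]; rewrite in_itv /=; exists k.
Qed.

(* The point is [\sum_i b i / 4 ^+ i.+1]; base 4 leaves room for the tail of
   the series to stay below one half of the last retained digit. *)
Lemma digit_surj (R : realType) (b : nat -> bool) :
  exists z : R, forall n, digit n z <-> b n.
Proof.
pose N := fix N n : nat := if n is m.+1 then (4 * N m + b m)%N else 0%N.
pose s n : R := (N n)%:R / 4 ^+ n.
pose u n : R := ((N n)%:R + 1 / 2) / 4 ^+ n.
have p4 n : 0 < 4 ^+ n :> R by rewrite exprn_gt0.
have NS n : (N n.+1)%:R = 4 * (N n)%:R + (b n)%:R :> R.
  by rewrite /= natrD natrM.
have b01 n : 0 <= (b n)%:R :> R /\ (b n)%:R <= 1 :> R.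
  by case: (b n); rewrite ?ler01 lexx.
have sS n : s n <= s n.+1.
  rewrite /s ler_pdivrMr // exprS invfM mulrA divfK ?gt_eqF// NS.
  by rewrite ler_pdivlMr //; have := b01 n; lra.
have uS n : u n.+1 <= u n.
  rewrite /u ler_pdivlMr // exprS invfM mulrA divfK ?gt_eqF// NS.
  by rewrite ler_pdivrMr //; have := b01 n; lra.
have su n : s n <= u n by rewrite /s /u ler_pM2r ?invr_gt0 //; lra.
have sm m n : (m <= n)%N -> s m <= s n.
  by move=> mn; apply: (homo_leq (@lexx _ _) (@le_trans _ _)).
have um m n : (m <= n)%N -> u n <= u m.
  by elim: n => [|n ih]; [rewrite leqn0 => /eqP->|
    rewrite leq_eqVlt ltnS => /predU1P[->//|/ih]; exact: le_trans].
have sun m n : s m <= u n.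
  case: (leqP m n) => [/sm h|/ltnW/um h]; first exact: le_trans h (su n).
  exact: le_trans (su m) h.
exists (sup (range s)) => n.
set z := sup _.
have sz : s n.+1 <= z.
  apply: ub_le_sup; last by exists n.+1.
  by exists (u 0%N) => _ [m _ <-].
have zu : z <= u n.+1.
  by apply: ge_sup; [exists (s 0%N); exists 0%N|move=> _ [m _ <-]].
have {sz} : (N n.+1)%:R <= z * 4 ^+ n.+1 by rewrite -ler_pdivrMr.
have {zu} : z * 4 ^+ n.+1 <= (N n.+1)%:R + 1 / 2 by rewrite -ler_pdivlMr.
(* Hence [z * 4 ^+ n.+1] has integer part [N n.+1], whose parity is [b n]. *)
move=> zu sz; split.
  move=> [k /andP[k1 k2]].
  have h1 : (k.*2.+1)%:R < (N n.+1).+1%:R :> R by rewrite -[X in _ < X]natr1; lra.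
  have h2 : (N n.+1)%:R < (k.*2.+2)%:R :> R by lra.
  by move: h1 h2; rewrite !ltr_nat /=; case: (b n); lia.
move=> bn; exists (N n).*2; rewrite (_ : (N n).*2.*2.+1 = N n.+1); last first.
  by rewrite /= bn; lia.
by rewrite -[X in _ && (_ < X)]natr1; apply/andP; split; lra.
Qed.

Lemma propM_rich_setT (R : realType) (I : set (set R)) :
  sigma_ideal I -> propM I -> rich I setT.
Proof.
move=> [sub _ _ _] [f [mf hf]].
exists (fun n => f @^-1` digit n) => [n|b].
  by rewrite -[X in measurable X]setTI; apply: mf => //; exact: measurable_digit.
have [z hz] := digit_surj R b.
move=> Ib; apply: (hf z); apply: sub Ib => p /= fp; split=> // n.
by rewrite /preimage /= fp.
Qed.

(** * Decoding Dedekind cuts *)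

Definition rat_enum (R : realType) (i : nat) : R :=
  ratr (odflt 0 (@unpickle rat i)).

(* Maps the code of a Dedekind cut to the real number that it defines, and is
   constantly [0] on the codes of the unbounded and empty sets. *)
Definition cut_decode (R : realType) (E : nat -> set R) (p : R) : R :=
  fine (esups (fun i => if p \in E i then (rat_enum R i)%:E else -oo%E) 0).

Lemma measurable_cut_decode (R : realType) (E : nat -> set R) :
  (forall i, measurable (E i)) -> measurable_fun setT (cut_decode E).
Proof.
move=> mE; apply: measurableT_comp; first exact: fine_measurable.
apply: measurable_fun_esups => i; apply: measurable_fun_ifT => //.
apply: (@measurable_fun_bool _ _ _ _ true).
rewrite setTI (_ : _ @^-1` _ = E i) //.
by apply/funext => p; rewrite /preimage /= -[RHS]asboolE.
Qed.

Lemma cut_decode_fiber (R : realType) (E : nat -> set R) (x p : R) :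
  fiber E (fun i => rat_enum R i < x) p -> cut_decode E p = x.
Proof.
move=> Ep; rewrite /cut_decode; set v := esups _ _.
suff -> : v = x%:E by [].
apply/eqP; rewrite eq_le; apply/andP; split.
  apply: ge_ereal_sup => _ [i _ <-]; case: ifP => [|_]; last exact: leNye.
  by rewrite inE lee_fin => /(Ep i)/ltW.
apply/lee_subgt0Pr => e e0.
have [r] := @rat_in_itvoo R (x - e) x ltac:(lra).
rewrite in_itv /= => /andP[r1 r2].
have rr : rat_enum R (pickle r) = ratr r by rewrite /rat_enum pickleK.
apply: (@le_trans _ _ (ratr r)%:E); first by rewrite -EFinB lee_fin ltW.
apply: ereal_sup_ubound; exists (pickle r) => //=.
rewrite ifT ?rr // inE; apply/(Ep (pickle r)).
by rewrite rr.
Qed.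

(** * Passage from a countable basis to all open sets *)

Theorem theorem6p2 (R : realType) (I : set (set R)) :
  sigma_ideal I -> translation_invariant I -> propM I -> propMstar I.
Proof.
move=> hI tr /(propM_rich_setT hI) rT.
(* Indices that code no pair give the unit ball at [0], so every [U n] is open and nonempty. *)
pose U n : set R :=
  let: (q, k) := odflt (0, 0%N) (@unpickle (rat * nat)%type n) in
  ball (ratr q : R) k.+1%:R^-1.
have oU n : open (U n).
  by rewrite /U; case: (odflt _ _) => q k; exact: ball_open.
have U0 n : U n !=set0.
  by rewrite /U; case: (odflt _ _) => q k; exists (ratr q); exact: ballxx.
have [E mE rE] := rich_for_glue hI (fun n => open_measurable (oU n))
  (fun n => open_rich hI tr rT (oU n) (U0 n)).
exists (cut_decode E); split; first exact: measurable_cut_decode.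
move=> x V oV [v Vv] Ix.
have [e e0 eV] : exists2 e : R, 0 < e & ball v e `<=` V.
  by have /nbhs_ballP[e e0 eV] := open_nbhs_nbhs (conj oV Vv); exists e.
have [k ke] : exists k : nat, k.+1%:R^-1 < e / 2.
  exists (Num.bound (e / 2)^-1).
  rewrite invf_plt ?posrE ?divr_gt0 //; apply: (lt_trans (archi_boundP _)).
    by rewrite invr_ge0 divr_ge0 // ltW.
  by rewrite ltr_nat.
have [q] := @rat_in_itvoo R v (v + e / 2) ltac:(lra).
rewrite in_itv /= => /andP[q1 q2].
have [n UV] : exists n, U n `<=` V.
  exists (pickle (q, k)); rewrite /U pickleK /= => p; rewrite /ball /= ltr_norml => hp.
  apply: eV; rewrite /ball /= ltr_norml.
  by move: (k.+1%:R^-1) ke hp => d ke hp; lra.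
(* On [U n], the fibre of [E] over the cut of [x] lies in the fibre of [cut_decode E] over [x]. *)
apply: (rE n (fun i => rat_enum R i < x)).
case: (hI) => sub _ _ _; apply: sub Ix => p [Up Ep]; split; last exact: UV.
exact: cut_decode_fiber.
Qed.
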